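(* Let $\Omega\subseteq\mathbb R^d$ be open and let $P^*(\partial)=\sum_{|\alpha|\le m}c_\alpha\,\partial^\alpha:\mathcal D^*(\Omega)\to\mathcal D^*(\Omega)$ be a linear partial differential operator with constant coefficients $c_\alpha\in\mathbb C$. Then $P^*(\partial)$ is regular. Consequently, $P^*(\partial)$ is surjective on $\mathcal D^*(\Omega)$: for every $T\in\mathcal D^*(\Omega)$ the equation $P^*(\partial)U=T$ has a solution $U\in\mathcal D^*(\Omega)$.
   Context: $\mathcal D(\Omega)=\mathcal C_0^\infty(\Omega)$ is the $\mathbb C$-vector space of smooth compactly supported functions $\Omega\to\mathbb C$ and $\mathcal D^*(\Omega)$ is its algebraic dual (all $\mathbb C$-linear functionals), with evaluation $\langle T,\varphi\rangle$. For a multi-index $\alpha\in\mathbb N_0^d$, $\partial^\alpha T$ is defined by $\langle\partial^\alpha T,\varphi\rangle=(-1)^{|\alpha|}\langle T,\partial^\alpha\varphi\rangle$ for all $\varphi\in\mathcal D(\Omega)$. Regular: a linear operator $\mathcal O^*$ on the algebraic dual $V^*$ of a vector space $V$ is regular if there is an injective linear operator $\mathcal O:V\to V$ (its co-dual, or transposed) with $\mathcal O^*(T)=T\circ\mathcal O$ for all $T\in V^*$. Here $V=\mathcal D(\Omega)$ and the co-dual of $P^*(\partial)$ is $P(\partial):\mathcal D(\Omega)\to\mathcal D(\Omega)$, $P(\partial)=\sum_{|\alpha|\le m}(-1)^{|\alpha|}c_\alpha\,\partial^\alpha$.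
   Formalization: The coefficients c_α are assumed not all zero; for the zero operator and nonempty Ω the claim fails, since the zero operator is neither regular nor surjective. *)

(* Defs.v *)
From HB Require Import structures.
From mathcomp Require Import all_boot all_order all_algebra.
From mathcomp Require Import all_classical all_reals.
From mathcomp Require Import topology normedtype derive.
From mathcomp Require Import complex.

Set Implicit Arguments.
Unset Strict Implicit.
Unset Printing Implicit Defensive.

Import Order.TTheory GRing.Theory Num.Theory.
Import numFieldNormedType.Exports.

Local Open Scope classical_set_scope.
Local Open Scope ring_scope.

Section AlgebraicDual.
Variables (K : comNzRingType) (V : lmodType K).

(* V^*: all linear functionals, with no continuity requirement. *)
Definition algdual : Type := {scalar V}.

Definition algdual_fun (T : algdual) : V -> K := (T : {scalar V}).
Coercion algdual_fun : algdual >-> Funclass.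

HB.instance Definition _ := gen_eqMixin algdual.
HB.instance Definition _ := gen_choiceMixin algdual.

Lemma algdual_ext (S T : algdual) : S =1 T -> S = T.
Proof.
case: S T => [s [[s1] [s2]]] [t [[t1] [t2]]] /funext st.
rewrite /algdual_fun /= in st; case: t / st t1 t2 => t1 t2.
by rewrite (Prop_irrelevance s1 t1) (Prop_irrelevance s2 t2).
Qed.

Lemma algdual_scalar (T : algdual) : scalar T.
Proof. exact: (linearP (T : {scalar V})). Qed.

Definition mk_algdual (f : V -> K) (f_lin : scalar f) : algdual :=
  HB.pack_for {scalar V} f (GRing.isLinear.Build K V K *%R f f_lin).

Lemma algdual_add_subproof (S T : algdual) : scalar (fun v => S v + T v).
Proof. by move=> a u v; rewrite !algdual_scalar mulrDr addrACA. Qed.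
Lemma algdual_opp_subproof (T : algdual) : scalar (fun v => - T v).
Proof. by move=> a u v; rewrite algdual_scalar opprD mulrN. Qed.
Lemma algdual_zero_subproof : scalar (fun _ : V => 0 : K).
Proof. by move=> a u v; rewrite mulr0 addr0. Qed.
Lemma algdual_scale_subproof (b : K) (T : algdual) :
  scalar (fun v => b * T v).
Proof. by move=> a u v; rewrite algdual_scalar mulrDr mulrCA. Qed.

Definition algdual_add S T := mk_algdual (algdual_add_subproof S T).
Definition algdual_opp T := mk_algdual (algdual_opp_subproof T).
Definition algdual_zero := mk_algdual algdual_zero_subproof.
Definition algdual_scale b T := mk_algdual (algdual_scale_subproof b T).

Lemma algdual_addA : associative algdual_add.
Proof. by move=> S T U; apply: algdual_ext => v; exact: addrA. Qed.
Lemma algdual_addC : commutative algdual_add.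
Proof. by move=> S T; apply: algdual_ext => v; exact: addrC. Qed.
Lemma algdual_add0 : left_id algdual_zero algdual_add.
Proof. by move=> T; apply: algdual_ext => v; exact: add0r. Qed.
Lemma algdual_addN : left_inverse algdual_zero algdual_opp algdual_add.
Proof. by move=> T; apply: algdual_ext => v; exact: addNr. Qed.

HB.instance Definition _ := GRing.isZmodule.Build algdual
  algdual_addA algdual_addC algdual_add0 algdual_addN.

Lemma algdual_scaleA a b T :
  algdual_scale a (algdual_scale b T) = algdual_scale (a * b) T.
Proof. by apply: algdual_ext => v; exact: mulrA. Qed.
Lemma algdual_scale1 : left_id 1 algdual_scale.
Proof. by move=> T; apply: algdual_ext => v; exact: mul1r. Qed.
Lemma algdual_scaleDr : right_distributive algdual_scale +%R.
Proof. by move=> a S T; apply: algdual_ext => v; exact: mulrDr. Qed.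
Lemma algdual_scaleDl T : {morph algdual_scale^~ T : a b / a + b}.
Proof. by move=> a b; apply: algdual_ext => v; exact: mulrDl. Qed.

HB.instance Definition _ := GRing.Zmodule_isLmodule.Build K algdual
  algdual_scaleA algdual_scale1 algdual_scaleDr algdual_scaleDl.

(* The injective operator O is the co-dual of Ostar. *)
Definition regular (Ostar : {linear algdual -> algdual}) : Prop :=
  exists2 O : {linear V -> V}, injective O & forall T, Ostar T =1 T \o O.
End AlgebraicDual.

Section MultiIndex.
Variables (d m : nat).

Definition mlength (a : 'I_d -> nat) : nat := \sum_i a i.

(* Entries of a multi-index of length at most m are themselves at most m. *)
Definition multiindex : Type :=
  {a : {ffun 'I_d -> 'I_m.+1} | (mlength (fun i => a i) <= m)%N}.

HB.instance Definition _ := Finite.on multiindex.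

Definition multiindex_fun (a : multiindex) : 'I_d -> nat :=
  fun i => (val a : {ffun 'I_d -> 'I_m.+1}) i.
Coercion multiindex_fun : multiindex >-> Funclass.
End MultiIndex.

Section TestFunctions.
Variables (R : realType) (d : nat).
Implicit Types (u v : 'rV[R]_d -> R) (f g : 'rV[R]_d -> R[i]).

Definition pderiv (i : 'I_d) u : 'rV[R]_d -> R := 'D_('e_i) u.

(* C^infinity: all iterated partial derivatives exist and are continuous. *)
Definition smooth u : Prop := forall s : seq 'I_d,
  let us := foldr pderiv u s in
  continuous us /\ forall i x, derivable us x ('e_i).

(* Partial derivatives of complex-valued functions are taken componentwise,
   as R[i] carries no normed R-module structure in the library. *)
Definition csmooth f : Prop :=
  smooth (fun x => complex.Re (f x)) /\ smooth (fun x => complex.Im (f x)).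

Definition cpderiv (i : 'I_d) f : 'rV[R]_d -> R[i] := fun x =>
  (pderiv i (fun y => complex.Re (f y)) x +i*
   pderiv i (fun y => complex.Im (f y)) x)%C.

Definition supp f : set 'rV[R]_d := closure [set x | f x != 0].

Lemma foldr_pderivD (a : R) u v s : smooth u -> smooth v ->
  foldr pderiv (a *: u + v) s = a *: foldr pderiv u s + foldr pderiv v s.
Proof.
move=> su sv; elim: s => [//|i s IH] /=.
rewrite IH /pderiv; apply/funext => x.
rewrite deriveD ?deriveZ//; [by case: (su s)|apply: derivableZ; by case: (su s)|
 by case: (sv s)].
Qed.

Lemma smoothD (a : R) u v : smooth u -> smooth v -> smooth (a *: u + v).
Proof.
move=> su sv s; rewrite /= foldr_pderivD//; have [cu du] := su s; have [cv dv] := sv s.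
split=> [x|i x]; last by apply: derivableD => //; exact: derivableZ.
have H : {for x, continuous ((a *: foldr pderiv u s : _ -> R) + foldr pderiv v s)}.
  apply: continuousD; last exact: cv.
  by apply: continuousM; [exact: cst_continuous|exact: cu].
exact: H.
Qed.

Lemma smooth0 : smooth 0.
Proof.
move=> s; have -> /= : foldr pderiv (0 : 'rV[R]_d -> R) s = cst 0.
  elim: s => [//|i s /= ->]; apply/funext => x; exact: derive_cst.
by split=> [x|i x]; [exact: cst_continuous|exact: derivable_cst].
Qed.

Lemma smooth_pderiv i u : smooth u -> smooth (pderiv i u).
Proof. by move=> su s; have := su (rcons s i); rewrite /= foldr_rcons. Qed.

Lemma csmooth_pderiv i f : csmooth f -> csmooth (cpderiv i f).
Proof. by case=> sr si; split; apply: smooth_pderiv. Qed.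

Lemma Re_scaleD (a : R[i]) f g : (fun x => complex.Re ((a *: f + g) x)) =
  complex.Re a *: (fun x => complex.Re (f x)) +
  (- complex.Im a *: (fun x => complex.Im (f x)) + (fun x => complex.Re (g x))).
Proof.
apply/funext => x; rewrite !fctE /=.
by case: (a) (f x) (g x) => [? ?] [? ?] [? ?] /=; rewrite /GRing.scale/= mulNr addrA.
Qed.

Lemma Im_scaleD (a : R[i]) f g : (fun x => complex.Im ((a *: f + g) x)) =
  complex.Re a *: (fun x => complex.Im (f x)) +
  (complex.Im a *: (fun x => complex.Re (f x)) + (fun x => complex.Im (g x))).
Proof.
apply/funext => x; rewrite !fctE /=.
by case: (a) (f x) (g x) => [? ?] [? ?] [? ?] /=; rewrite /GRing.scale/= addrA.
Qed.

Lemma csmoothD (a : R[i]) f g : csmooth f -> csmooth g -> csmooth (a *: f + g).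
Proof.
move=> [fr fi] [gr gi]; split.
- by rewrite Re_scaleD; exact: (smoothD _ fr (smoothD _ fi gr)).
- by rewrite Im_scaleD; exact: (smoothD _ fi (smoothD _ fr gi)).
Qed.

Lemma cpderivD i (a : R[i]) f g : csmooth f -> csmooth g ->
  cpderiv i (a *: f + g) = a *: cpderiv i f + cpderiv i g.
Proof.
move=> [fr fi] [gr gi]; apply/funext => x; rewrite /cpderiv Re_scaleD Im_scaleD.
have E b u v : smooth u -> smooth v ->
    pderiv i (b *: u + v) x = b * pderiv i u x + pderiv i v x.
  by move=> su sv; rewrite -[LHS]/(foldr pderiv _ [:: i] x) foldr_pderivD.
rewrite (E _ _ _ fr (smoothD _ fi gr)) (E _ _ _ fi gr).
rewrite (E _ _ _ fi (smoothD _ fr gi)) (E _ _ _ fr gi).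
rewrite !fctE /=; case: (a) => p q.
by congr Complex; rewrite /= addrA ?mulNr.
Qed.

Lemma supp0 f x : x \notin supp f -> f x = 0.
Proof.
move=> /negP xf; apply/eqP; apply: contrapT => /negP fx0; apply: xf.
by rewrite inE; apply: subset_closure.
Qed.

Lemma supp_pderiv i f : supp (cpderiv i f) `<=` supp f.
Proof.
rewrite [X in _ `<=` X](closure_id _).1; last exact: closed_closure.
apply: closure_subset => x /=; apply: contra_neqP => xf.
have near0 : \forall y \near x, f y = 0.
  have := open_nbhs_nbhs (conj (closed_openC (@closed_closure _ [set x | f x != 0])) xf).
  by apply: filterS => y fy; apply: supp0; rewrite notin_setE.
rewrite /cpderiv /pderiv.
have E u : (\forall y \near x, u y = 0) -> 'D_('e_i) u x = 0.
  by move=> u0; rewrite (near_eq_derive (g := cst 0))// derive_cst.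
by rewrite !E//; apply: filterS near0 => y ->.
Qed.

Lemma suppD (a : R[i]) f g : supp (a *: f + g) `<=` supp f `|` supp g.
Proof.
rewrite /supp -closureU; apply: closure_subset => x /=; apply: contra_neqP.
move=> /not_orP[/negP]; rewrite negbK => /eqP fx /negP; rewrite negbK => /eqP gx.
by rewrite !fctE fx gx scaler0 addr0.
Qed.

(* A smooth compactly supported function Omega -> C is represented by its
   extension by zero to R^d; for open Omega these extensions are exactly the
   smooth functions on R^d whose support is compact and contained in Omega. *)
Definition is_test (Omega : set 'rV[R]_d) f : Prop :=
  [/\ csmooth f, compact (supp f) & supp f `<=` Omega].

Lemma is_testD Omega a f g :
  is_test Omega f -> is_test Omega g -> is_test Omega (a *: f + g).
Proof.
move=> [sf cf fO] [sg cg gO]; split; first exact: csmoothD.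
- apply: (subclosed_compact _ _ (@suppD a f g)); first exact: closed_closure.
  exact: compactU.
- by apply: (subset_trans (@suppD a f g)); rewrite subUset.
Qed.

Lemma is_test0 Omega : is_test Omega 0.
Proof.
have s0 : supp 0 = set0.
  rewrite /supp (_ : [set x | _] = set0) ?closure0//.
  by apply/seteqP; split=> x //=; rewrite eqxx.
by split; rewrite ?s0//; [split; exact: smooth0|exact: compact0].
Qed.

Lemma is_test_pderiv Omega i f : is_test Omega f -> is_test Omega (cpderiv i f).
Proof.
move=> [sf cf fO]; split; first exact: csmooth_pderiv.
- by apply: (subclosed_compact _ cf (@supp_pderiv i f)); exact: closed_closure.
- exact: subset_trans (@supp_pderiv i f) fO.
Qed.

Variable Omega : set 'rV[R]_d.

Definition test_pred : {pred 'rV[R]_d -> R[i]} := fun f => `[< is_test Omega f >].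

Lemma test_submod_closed : submod_closed test_pred.
Proof.
split=> [|a f g]; first by apply/asboolP; exact: is_test0.
by move=> /asboolP tf /asboolP tg; apply/asboolP; exact: is_testD.
Qed.

HB.instance Definition _ :=
  GRing.isSubmodClosed.Build R[i] ('rV[R]_d -> R[i]) test_pred test_submod_closed.

Record testfun : Type := TestFun
  { testfun_val :> 'rV[R]_d -> R[i]; testfun_subproof : testfun_val \in test_pred }.

HB.instance Definition _ := [isSub of testfun for testfun_val].
HB.instance Definition _ := [Choice of testfun by <:].
HB.instance Definition _ := [SubChoice_isSubLmodule of testfun by <:].

Lemma testfun_valD (a : R[i]) (phi psi : testfun) :
  testfun_val (a *: phi + psi) = a *: testfun_val phi + testfun_val psi.
Proof. by []. Qed.

Lemma testfunP (phi : testfun) : is_test Omega phi.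
Proof. exact/asboolP/(valP phi). Qed.

Lemma tpderiv_subproof i (phi : testfun) : cpderiv i phi \in test_pred.
Proof. exact/asboolP/is_test_pderiv/testfunP. Qed.

Definition tpderiv i (phi : testfun) : testfun :=
  TestFun (tpderiv_subproof i phi).

Lemma tpderiv_linear i : linear (tpderiv i).
Proof.
move=> a phi psi; apply: val_inj.
change (cpderiv i (a *: testfun_val phi + testfun_val psi) = a *: cpderiv i phi + cpderiv i psi).
by apply: cpderivD; [have [] := testfunP phi|have [] := testfunP psi].
Qed.

HB.instance Definition _ i :=
  GRing.isLinear.Build R[i] testfun testfun *:%R (tpderiv i) (tpderiv_linear i).

Definition tdiff (a : 'I_d -> nat) (phi : testfun) : testfun :=
  foldr (fun i => iter (a i) (tpderiv i)) phi (enum 'I_d).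

Lemma tdiff_linear a : linear (tdiff a).
Proof.
move=> b phi psi; rewrite /tdiff.
elim: (enum 'I_d) => [//|i s /= ->].
by elim: (a i) => [//|n /= ->]; rewrite linearP.
Qed.

HB.instance Definition _ a :=
  GRing.isLinear.Build R[i] testfun testfun *:%R (tdiff a) (tdiff_linear a).

Lemma ddiff_subproof (a : 'I_d -> nat) (T : algdual testfun) :
  scalar (fun phi : testfun => (-1) ^+ mlength a * T (tdiff a phi)).
Proof. by move=> b phi psi; rewrite linearP algdual_scalar mulrDr mulrCA. Qed.

Definition ddiff (a : 'I_d -> nat) (T : algdual testfun) : algdual testfun :=
  mk_algdual (ddiff_subproof a T).

Lemma ddiff_linear a : linear (ddiff a).
Proof.
move=> b S T; apply: algdual_ext => phi.
by rewrite [LHS]mulrDr mulrCA.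
Qed.

HB.instance Definition _ a :=
  GRing.isLinear.Build R[i] (algdual testfun) (algdual testfun) *:%R (ddiff a) (ddiff_linear a).

Definition pdo m (c : multiindex d m -> R[i]) (T : algdual testfun) : algdual testfun :=
  \sum_(a : multiindex d m) c a *: ddiff (multiindex_fun a) T.

Lemma pdo_linear m (c : multiindex d m -> R[i]) : linear (pdo c).
Proof.
move=> b S T; rewrite /pdo scaler_sumr -big_split; apply: eq_bigr => a _ /=.
by rewrite linearP scalerDr !scalerA mulrC.
Qed.

HB.instance Definition _ m (c : multiindex d m -> R[i]) :=
  GRing.isLinear.Build R[i] (algdual testfun) (algdual testfun) *:%R (pdo c) (pdo_linear c).
End TestFunctions.

(* Main.v *)
From HB Require Import structures.
Require Import Defs.
From mathcomp Require Import all_boot all_order all_algebra.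
From mathcomp Require Import all_classical all_reals.
From mathcomp Require Import topology normedtype derive.
From mathcomp Require Import complex ring lra.

Import Order.TTheory GRing.Theory Num.Theory.
Import numFieldNormedType.Exports.

Local Open Scope classical_set_scope.
Local Open Scope ring_scope.

(** The transposed operator is injective by Hörmander's commutator trick.  If
    [T] is a constant-coefficient operator with formal adjoint [T'], then [T]
    and [T'] commute, so [T f = 0] gives [|T' f|^2 = <T T' f, f> = 0].  Let [Q]
    be the commutator of [T] with multiplication by [x_j]; it is again a
    constant-coefficient operator, with symbol the [j]-th partial derivative of
    the symbol of [T], and [|Q f|^2 = <T (x_j f), Q f> = <x_j f, Q (T' f)> = 0].
    Differentiating the symbol until only a nonzero constant is left gives
    [f = 0].  No integral is needed for the pairing: it suffices to know which
    functions have Riemann sums tending to [0], and these include all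
    derivatives of test functions.  Surjectivity follows by extending the
    functional [P(f) |-> T(f)] from the range of [P] with Zorn's lemma. *)

(** * Smooth real functions: products, coordinates, restriction to lines *)

Section SmoothFunctions.
Set Implicit Arguments.
Unset Strict Implicit.
Context {R : realType} {d : nat}.
Implicit Types (u v : 'rV[R]_d -> R) (i j : 'I_d) (x : 'rV[R]_d).

Lemma smooth_continuous u : smooth u -> continuous u.
Proof. by move=> /(_ [::])[]. Qed.

Lemma smooth_derivable u i x : smooth u -> derivable u x ('e_i).
Proof. by move=> /(_ [::])[]. Qed.

(** Coinduction principle: closure of [C] under [pderiv] carries continuity and differentiability to
    every iterated derivative. *)
Lemma smooth_coind (C : ('rV[R]_d -> R) -> Prop) :
  (forall u, C u -> [/\ continuous u, forall i x, derivable u x ('e_i) &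
     forall i, C (pderiv i u)]) ->
  forall u, C u -> smooth u.
Proof.
move=> HC u Cu s.
suff /HC[] : C (foldr (@pderiv R d) u s) by [].
by elim: s => [//|i s IH] /=; have [_ _] := HC _ IH; exact.
Qed.

Lemma pderivD i u v : smooth u -> smooth v ->
  pderiv i (u + v) = pderiv i u + pderiv i v.
Proof. by move=> su sv; have := foldr_pderivD 1 [:: i] su sv; rewrite /= !scale1r. Qed.

Lemma smooth_add u v : smooth u -> smooth v -> smooth (u + v).
Proof. by move=> su sv; rewrite -[u]scale1r; exact: smoothD. Qed.

Lemma smooth_opp u : smooth u -> smooth (- u).
Proof. by move=> su; rewrite -[- u]addr0 -scaleN1r; exact: (smoothD (-1) su (@smooth0 R d)). Qed.

Lemma smooth_sub u v : smooth u -> smooth v -> smooth (u - v).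
Proof. by move=> su sv; exact: (smooth_add su (smooth_opp sv)). Qed.

Lemma pderivM i u v : smooth u -> smooth v ->
  pderiv i (u * v) = u * pderiv i v + v * pderiv i u.
Proof.
move=> su sv; apply/funext => x; rewrite /pderiv deriveM//; exact: smooth_derivable.
Qed.

(** By the Leibniz rule, derivatives of a product are sums of products; this closure is therefore
    stable under [pderiv] and serves as the class in [smooth_coind]. *)
Inductive smooth_alg : ('rV[R]_d -> R) -> Prop :=
| smooth_alg_base u : smooth u -> smooth_alg u
| smooth_alg_add u v : smooth_alg u -> smooth_alg v -> smooth_alg (u + v)
| smooth_alg_mul u v : smooth_alg u -> smooth_alg v -> smooth_alg (u * v).

Lemma smooth_mul u v : smooth u -> smooth v -> smooth (u * v).
Proof.
move=> su sv; apply: (@smooth_coind smooth_alg); last first.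
  by apply: smooth_alg_mul; exact: smooth_alg_base.
move=> {}u {su sv}; elim=> {u} [u su|u w Cu [cu du pu] Cw [cw dw pw]
    |u w Cu [cu du pu] Cw [cw dw pw]].
- split; [exact: smooth_continuous|by move=> i x; exact: smooth_derivable|].
  by move=> i; apply/smooth_alg_base/smooth_pderiv.
- split.
  + by move=> x; apply: (@continuousD _ _ _ u w x); [exact: cu|exact: cw].
  + by move=> i x; apply: derivableD.
  + move=> i; have -> : pderiv i (u + w) = pderiv i u + pderiv i w.
      by apply/funext => x; rewrite /pderiv deriveD.
    by apply: smooth_alg_add.
- split.
  + by move=> x; apply: (@continuousM _ _ u w x); [exact: cu|exact: cw].
  + by move=> i x; apply: derivableM.
  + move=> i; have -> : pderiv i (u * w) = u * pderiv i w + w * pderiv i u.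
      by apply/funext => x; rewrite /pderiv deriveM.
    by apply: smooth_alg_add; apply: smooth_alg_mul.
Qed.

Definition coord j : 'rV[R]_d -> R := fun x => x 0 j.

Lemma is_derive_coord i j x : is_derive x ('e_i) (coord j) (i == j)%:R.
Proof.
have H : h^-1 *: ((coord j \o shift x) (h *: 'e_i) - coord j x) @[h --> 0^'] --> ((i == j)%:R : R).
  apply: (@cvg_trans _ ((fun=> (i == j)%:R : R) @ 0^')); last exact: cvg_cst.
  apply: near_eq_cvg; near=> h.
  have h0 : h != 0 by near: h; exact: nbhs_dnbhs_neq.
  by rewrite /coord /= !mxE eqxx /= addrK eq_sym /GRing.scale /= mulKf.
split; first by apply/cvg_ex; exists (i == j)%:R.
exact: cvg_lim H.
Unshelve. all: by end_near. Qed.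

Lemma pderiv_coord i j : pderiv i (coord j) = cst (i == j)%:R.
Proof. by apply/funext => x; have [_] := is_derive_coord i j x. Qed.

Lemma smooth_coord j : smooth (coord j).
Proof.
apply: (@smooth_coind (fun u => u = coord j \/ exists r, u = cst r)); last by left.
move=> u [->|[r ->]]; split.
- by move=> x; exact: coord_continuous.
- by move=> i x; have [] := is_derive_coord i j x.
- by move=> i; right; exists (i == j)%:R; exact: pderiv_coord.
- by move=> x; exact: cst_continuous.
- by move=> i x; exact: derivable_cst.
- by move=> i; right; exists 0; apply/funext => x; exact: derive_cst.
Qed.

(** Turns a partial derivative into a one-variable one, so that the mean value theorem applies along
    a line. *)
Lemma is_derive_line u i x (t : R) : smooth u ->
  is_derive t 1 (fun s : R => u (x + s *: 'e_i)) (pderiv i u (x + t *: 'e_i)).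
Proof.
move=> su; have du : derivable u (x + t *: 'e_i) 'e_i by exact: smooth_derivable.
have E : (fun h : R => h^-1 *: (((fun s : R => u (x + s *: 'e_i)) \o shift t) (h *: 1) -
    u (x + t *: 'e_i))) =
  (fun h : R => h^-1 *: ((u \o shift (x + t *: 'e_i)) (h *: 'e_i) - u (x + t *: 'e_i))).
  apply/funext => h /=; congr (_ *: (u _ - _)).
  by rewrite /GRing.scale /= mulr1 -/(GRing.scale _ _) scalerDl addrCA.
by split; rewrite /derivable /derive E.
Qed.

End SmoothFunctions.

(** * Symmetry of mixed second derivatives *)

Section Schwarz.
Set Implicit Arguments.
Unset Strict Implicit.
Context {R : realType} {d : nat}.
Implicit Types (u v : 'rV[R]_d -> R) (i j : 'I_d) (x : 'rV[R]_d) (h : R).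

Lemma mean_value0 (f df : R -> R) h : 0 < h ->
  (forall t : R, is_derive t 1 f (df t)) ->
  exists2 c, 0 < c < h & f h - f 0 = h * df c.
Proof.
move=> h0 Hf.
have cf : {within `[0, h], continuous f}.
  by apply: derivable_within_continuous => t _; have [] := Hf t.
have [c ch E] := MVT h0 (fun t _ => Hf t) cf.
by exists c; [move: ch; rewrite in_itv|rewrite E subr0 mulrC].
Qed.

Lemma line_mean_value u i x h : smooth u -> 0 < h ->
  exists2 c, 0 < c < h & u (x + h *: 'e_i) - u x = h * pderiv i u (x + c *: 'e_i).
Proof.
move=> su h0; have [c ch E] := mean_value0 h0 (fun t => is_derive_line i x t su).
by exists c => //; rewrite -E scale0r addr0.
Qed.

(** The mean value theorem is used twice: in direction [i] on the increment of [u] along ['e_j],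
    then in direction [j] on [pderiv i u]. *)
Lemma second_difference u i j x h : smooth u -> 0 < h ->
  exists c e, [/\ 0 < c < h, 0 < e < h &
    u (x + h *: 'e_j + h *: 'e_i) - u (x + h *: 'e_i) - (u (x + h *: 'e_j) - u x)
    = h * (h * pderiv j (pderiv i u) (x + c *: 'e_i + e *: 'e_j))].
Proof.
move=> su h0.
have [|c ch E] := @mean_value0
   (fun t => u (x + h *: 'e_j + t *: 'e_i) - u (x + t *: 'e_i))
   (fun t => pderiv i u (x + h *: 'e_j + t *: 'e_i) - pderiv i u (x + t *: 'e_i)) h h0.
  by move=> t; apply: is_deriveB; exact: is_derive_line.
have [e eh E'] := line_mean_value j (x + c *: 'e_i) (smooth_pderiv i su) h0.
by exists c, e; split => //; rewrite -E' -[in RHS]addrAC -E !scale0r !addr0.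
Qed.

(** The second difference is symmetric in [i] and [j], so the two mixed derivatives agree at two
    points arbitrarily close to [x]; continuity brings the equality to [x]. *)
Lemma pderivC u i j : smooth u -> pderiv i (pderiv j u) = pderiv j (pderiv i u).
Proof.
move=> su; apply/funext => x; apply/eqP; rewrite -subr_eq0 -normr_eq0; apply/eqP.
set A := pderiv i _; set B := pderiv j (pderiv i u).
have cA : continuous A by apply: smooth_continuous; do 2 apply: smooth_pderiv.
have cB : continuous B by apply: smooth_continuous; do 2 apply: smooth_pderiv.
apply/le_anti; rewrite normr_ge0 andbT; apply/ler_addgt0Pr => eps eps0.
rewrite add0r; have e20 : 0 < eps / 2 by rewrite divr_gt0.
have [r r0 Hr] : exists2 r : R, 0 < r & forall y, `|x - y| < r ->
    `|A x - A y| < eps / 2 /\ `|B x - B y| < eps / 2.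
  have : \forall y \near x, `|A x - A y| < eps / 2 /\ `|B x - B y| < eps / 2.
    have HA := (@cvgrPdist_lt _ _ _ _ _ A (A x)).1 (cA x) _ e20.
    have HB := (@cvgrPdist_lt _ _ _ _ _ B (B x)).1 (cB x) _ e20.
    exact: (filterS2 _ (fun y Ay By => conj Ay By) (HA (nbhs_filter x)) (HB (nbhs_filter x))).
  by move=> /nbhs_ballP[r /= r0 H]; exists r => // y xy; apply: H; rewrite -ball_normE.
(* With [h * K = r], steps shorter than [h] in both directions stay within [r] of [x]; the [+ 1]
   keeps [K] positive. *)
pose K : R := `|'e_i : 'rV[R]_d| + `|'e_j : 'rV[R]_d| + 1.
have K0 : 0 < K by rewrite ltr_wpDl// addr_ge0.
pose h := r / K; have h0 : 0 < h by rewrite divr_gt0.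
have near_x k l c e : (k, l) = (i, j) \/ (k, l) = (j, i) -> 0 < c < h -> 0 < e < h ->
    `|x - (x + c *: 'e_k + e *: 'e_l)| < r.
  move=> kl /andP[c0 ch] /andP[e0 eh].
  rewrite -addrA opprD addrA subrr add0r normrN.
  have -> : r = h * K by rewrite /h divfK// gt_eqF.
  apply: (@le_lt_trans _ _ (h * (`|'e_k : 'rV[R]_d| + `|'e_l : 'rV[R]_d|))).
    rewrite (le_trans (ler_normD _ _))// !normrZ mulrDr !gtr0_norm//.
    by apply: lerD; rewrite ler_wpM2r// ltW.
  rewrite ltr_pM2l// /K.
  by case: kl => -[-> ->]; rewrite ?ltrDl// [`|'e_j| + _]addrC ltrDl.
have [c [e [ch eh E1]]] := second_difference i j x su h0.
have [c' [e' [ch' eh' E2]]] := second_difference j i x su h0.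
(* Both sides, multiplied by [h] twice, are the same second difference with its two middle terms
   exchanged. *)
have : B (x + c *: 'e_i + e *: 'e_j) = A (x + c' *: 'e_j + e' *: 'e_i).
  apply: (@mulfI _ h); first by rewrite gt_eqF.
  apply: (@mulfI _ h); first by rewrite gt_eqF.
  refine (etrans (esym E1) (etrans _ E2)).
  have swap (r1 r2 r3 r4 : R) : r1 - r2 - (r3 - r4) = r1 - r3 - (r2 - r4).
    by rewrite !opprB [r4 - r3]addrC addrACA [- r2 + r4]addrC.
  by rewrite (addrAC x) swap.
have /Hr[_ Hb] := near_x i j c e (or_introl erefl) ch eh.
have /Hr[Ha _] := near_x j i c' e' (or_intror erefl) ch' eh'.
move=> AB; rewrite AB in Hb; move: Ha Hb.
move: (A x) (B x) (A (x + c' *: 'e_j + e' *: 'e_i)) => a b z Ha Hb.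
apply: (le_trans (ler_distD z a b)).
rewrite [leRHS]splitr; apply: lerD; apply: ltW; first exact: Ha.
by rewrite distrC; exact: Hb.
Qed.

End Schwarz.

(** * Riemann sums and functions of integral zero *)

Section RiemannSums.
Set Implicit Arguments.
Unset Strict Implicit.
Context {R : realType} {d : nat}.
Implicit Types (u v : 'rV[R]_d -> R) (K : set 'rV[R]_d) (i j : 'I_d) (x : 'rV[R]_d).
Implicit Types (M n : nat).

Lemma vanish_pderiv K u i : closed K -> (forall x, ~ K x -> u x = 0) ->
  forall x, ~ K x -> pderiv i u x = 0.
Proof.
move=> cK uK x Kx; rewrite /pderiv (near_eq_derive (g := cst 0)) ?derive_cst//.
have := open_nbhs_nbhs (conj (closed_openC cK) Kx).
by apply: filterS => y /uK.
Qed.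

Lemma continuous_bounded_on K u : compact K -> continuous u ->
  exists C : R, forall x, K x -> `|u x| <= C.
Proof.
move=> cK cu; have : compact (u @` K).
  by apply: continuous_compact => //; exact: continuous_subspaceT.
move=> /compact_bounded[C [_ HC]]; exists (C + 1) => x Kx.
by apply: (HC (C + 1)); [rewrite ltrDl|exists x].
Qed.

Lemma continuous_bounded K u : compact K -> continuous u ->
  (forall x, ~ K x -> u x = 0) -> exists C : R, forall x, `|u x| <= C.
Proof.
move=> cK cu uK; have [C HC] := continuous_bounded_on cK cu.
exists (Num.max C 0) => x; rewrite le_max.
have [/HC ->//|/uK ->] := pselect (K x).
by rewrite normr0 lexx orbT.
Qed.

Definition mesh n : R := n.+1%:R^-1.

Lemma mesh_gt0 n : 0 < mesh n. Proof. by rewrite invr_gt0 ltr0n. Qed.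

Lemma mesh_ge0 n : 0 <= mesh n. Proof. exact/ltW/mesh_gt0. Qed.

Lemma mesh_natr n : n.+1%:R * mesh n = 1.
Proof. by rewrite divff// pnatr_eq0. Qed.

(** The points of mesh [1 / (n + 1)] in the cube [[-M, M[ ^ d]; the half-open cube makes the number
    of points per axis exactly [2 * M * n.+1]. *)
Definition gridpt M n (k : {ffun 'I_d -> 'I_(2 * M * n.+1)}) : 'rV[R]_d :=
  \row_i ((k i)%:R * mesh n - M%:R).

Definition riemann M n u : R := mesh n ^+ d * \sum_k u (@gridpt M n k).

(* Stands for "the integral of u is 0" without defining the integral. *)
Definition null u : Prop :=
  exists M0, forall M, (M0 <= M)%N ->
  exists C : R, forall n, `|riemann M n u| <= C * mesh n.

Lemma null0 : null 0.
Proof.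
exists 0%N => M _; exists 0 => n; rewrite /riemann big1 ?mulr0 ?normr0 ?mul0r//.
Qed.

Lemma null_lin (a : R) u v : null u -> null v -> null (a *: u + v).
Proof.
move=> [M1 H1] [M2 H2]; exists (maxn M1 M2) => M; rewrite geq_max => /andP[m1 m2].
have [C1 {}H1] := H1 _ m1; have [C2 {}H2] := H2 _ m2.
exists (`|a| * C1 + C2) => n.
have -> : riemann M n (a *: u + v) = a * riemann M n u + riemann M n v.
  rewrite /riemann mulrCA -mulrDr; congr (_ * _).
  by rewrite mulr_sumr -big_split.
rewrite (le_trans (ler_normD _ _))// mulrDl; apply: lerD => //.
by rewrite normrM -mulrA ler_wpM2l.
Qed.

(** Wrapping around makes the translation by one mesh a permutation of the grid, hence available for
    reindexing sums. *)
Definition cyclic_shift L i (k : {ffun 'I_d -> 'I_L}) : {ffun 'I_d -> 'I_L} :=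
  [ffun j => if j == i then ordS (k j) else k j].

Lemma cyclic_shift_inj L i : injective (@cyclic_shift L i).
Proof.
move=> k l /ffunP kl; apply/ffunP => j; have := kl j; rewrite !ffunE.
by case: ifP => // _ /ordS_inj.
Qed.

(* Both sides vanish when the shift wraps around a face of the cube. *)
Lemma gridpt_shift M n u i (k : {ffun 'I_d -> 'I_(2 * M * n.+1)}) :
  (forall x, M%:R <= `|x 0 i| -> u x = 0) ->
  u (gridpt (cyclic_shift i k)) = u (gridpt k + mesh n *: 'e_i).
Proof.
move=> u0; have := ltn_ord (k i); rewrite leq_eqVlt => /orP[/eqP kL|kL].
  rewrite !u0//; last by rewrite mxE ffunE eqxx /= kL modnn mul0r sub0r normrN ger0_norm.
  rewrite !mxE !eqxx /= mulr1 -addrA [- _ + _]addrC addrA -[X in _ + X - _]mul1r -mulrDl.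
  rewrite natr1 kL natrM -mulrA mesh_natr mulr1.
  by rewrite mul2n -addnn natrD addrK ger0_norm.
congr u; apply/rowP => j; rewrite !mxE !ffunE eqxx /=; case: eqP => [->|_] /=.
  by rewrite modn_small// mulr1 mulrSr mulrDl mul1r addrAC.
by rewrite mulr0 addr0.
Qed.

(** The quotient is the derivative at an intermediate point at distance less than [mesh n]; a second
    use of the mean value theorem bounds the change of the derivative up to there. *)
Lemma difference_quotient_error u i (C : R) x n : smooth u ->
  (forall y, `|pderiv i (pderiv i u) y| <= C) ->
  `|pderiv i u x - (u (x + mesh n *: 'e_i) - u x) / mesh n| <= C * mesh n.
Proof.
move=> su HC; have [c /andP[c0 ch] ->] := line_mean_value i x su (mesh_gt0 n).
rewrite mulrAC mulfV ?gt_eqF ?mesh_gt0// mul1r distrC.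
have [e _ ->] := line_mean_value i x (smooth_pderiv i su) c0.
by rewrite normrM [`|c|]gtr0_norm// mulrC; apply: ler_pM; rewrite // ltW.
Qed.

(** Replacing the derivative by difference quotients makes the sum cancel under [cyclic_shift]; only
    the error of order [mesh n] at each grid point remains. *)
Lemma null_pderiv K u i : smooth u -> compact K -> (forall x, ~ K x -> u x = 0) ->
  null (pderiv i u).
Proof.
move=> su cK uK; have clK := compact_closed (@norm_hausdorff _ _) cK.
have [C HC] : exists C : R, forall x, `|pderiv i (pderiv i u) x| <= C.
  apply: (continuous_bounded cK).
    by apply: smooth_continuous; do 2 apply: smooth_pderiv.
  move=> x; apply: (@vanish_pderiv K) => //.
  by move=> y; apply: (@vanish_pderiv K).
have [B HB] := continuous_bounded_on cK (@coord_continuous _ _ _ 0 i).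
(* Since [B] bounds the [i]-th coordinate on [K], any such [M] puts the faces of the cube orthogonal
   to ['e_i] outside [K]. In the constant, [(2 * M) ^ d] is the volume of the cube. *)
exists (Num.truncn B).+1 => M BM; exists ((2 * M)%:R ^+ d * C) => n.
have u0 x : M%:R <= `|x 0 i| -> u x = 0.
  move=> Mx; apply: uK => /HB; apply/negP; rewrite -ltNge.
  by rewrite (lt_le_trans (truncnS_gt B))// (le_trans _ Mx)// ler_nat.
have E : \sum_k (u (@gridpt M n k + mesh n *: 'e_i) - u (gridpt k)) = 0.
  rewrite sumrB; apply/eqP; rewrite subr_eq0; apply/eqP.
  rewrite [RHS](reindex_inj (@cyclic_shift_inj _ i)).
  by apply: eq_bigr => k _; rewrite gridpt_shift.
have -> : riemann M n (pderiv i u) = mesh n ^+ d * \sum_k (pderiv i u (@gridpt M n k) -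
    (u (@gridpt M n k + mesh n *: 'e_i) - u (gridpt k)) / mesh n).
  by rewrite sumrB -mulr_suml E mul0r subr0.
rewrite normrM ger0_norm ?exprn_ge0 ?mesh_ge0//.
apply: (@le_trans _ _ (mesh n ^+ d * \sum_(k : {ffun 'I_d -> 'I_(2 * M * n.+1)}) (C * mesh n))).
  rewrite ler_wpM2l ?exprn_ge0 ?mesh_ge0// (le_trans (ler_norm_sum _ _ _))//.
  by apply: ler_sum => k _; exact: difference_quotient_error.
rewrite sumr_const card_ffun !card_ord -[C * mesh n *+ _]mulr_natl natrX mulrA -exprMn.
by rewrite [mesh n * _]mulrC natrM -[_ * n.+1%:R * _]mulrA mesh_natr mulr1 mulrA.
Qed.

(** If [u] were positive at [x0], a small cube around [x0] would give every fine Riemann sum a fixed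
    positive share, against the bound [C * mesh n]. *)
Lemma null_ge0_eq0 u : continuous u -> (forall x, 0 <= u x) -> null u ->
  forall x, u x = 0.
Proof.
move=> cu u0 [M0 nu] x0; apply/eqP; rewrite eq_le u0 andbT leNgt; apply/negP => ux0.
pose eps := u x0 / 2; have eps0 : 0 < eps by rewrite divr_gt0.
(* Balls of row vectors are defined entrywise, so the neighbourhood obtained is a cube. *)
have [r r0 Hr] : exists2 r : R, 0 < r &
    forall y : 'rV[R]_d, (forall i, `|x0 0 i - y 0 i| < r) -> eps <= u y.
  have : \forall y \near x0, `|u x0 - u y| < eps.
    exact: ((@cvgrPdist_lt _ _ _ _ _ u (u x0)).1 (cu x0) _ eps0).
  move=> /nbhs_ballP[r /= r0 H]; exists r => // y xy.
  have /H : ball x0 r y by split=> // a i; rewrite ord1 -ball_normE; exact: xy.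
  rewrite /= ltr_norml => /andP[_]; rewrite ltrBlDr -ltrBlDl.
  by rewrite [X in X - _ < _](splitr (u x0)) addrK => /ltW.
pose p := (Num.truncn r^-1).+1.
have p0 : 0 < p%:R :> R by rewrite ltr0n.
have pr : p%:R^-1 < r.
  by rewrite -[ltRHS]invrK ltf_pV2 ?posrE ?invr_gt0// truncnS_gt.
(* The successors leave a margin of 2 between [x0] and the faces, so that the small cube of side
   [1 / p], at most 1, lies inside the grid. *)
pose M := maxn M0 (Num.truncn (\sum_i `|x0 0 i|)).+3.
have xM i : `|x0 0 i| + 2 <= M%:R.
  apply: (@le_trans _ _ ((Num.truncn (\sum_i `|x0 0 i|)).+1%:R + 2)).
    rewrite lerD2r (le_trans _ (ltW (truncnS_gt _)))//.
    by rewrite (bigD1 i)//= lerDl sumr_ge0.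
  by rewrite -natrD ler_nat addn2 leq_max leqnn orbT.
have [C HC] := nu M (leq_maxl _ _).
(* For [n.+1 = p * q] the grid has [q ^ d] points in the cube of side [1 / p]
   at [x0], where [eps <= u], so [riemann M n u] stays away from 0. *)
have key q : (0 < q)%N -> p%:R^-1 ^+ d * eps * p%:R * q%:R <= C.
  move=> q0; pose n := (p * q).-1.
  have n1 : n.+1 = (p * q)%N by rewrite prednK// muln_gt0.
  have qh : q%:R * mesh n = p%:R^-1.
    by rewrite /mesh n1 natrM invfM mulrCA mulfV ?mulr1// pnatr_eq0 -lt0n.
  have h0 := mesh_gt0 n.
  (* Index of the last grid coordinate not exceeding [x0 0 i]. *)
  pose k0 i := Num.truncn ((x0 0 i + M%:R) * n.+1%:R).
  have xM0 i : 0 <= x0 0 i + M%:R.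
    rewrite addrC -[x0 0 i]opprK subr_ge0 (le_trans (ler_norm _))// normrN.
    by rewrite (le_trans _ (xM i))// lerDl.
  have k0P i : (k0 i)%:R <= (x0 0 i + M%:R) * n.+1%:R < (k0 i).+1%:R.
    by apply/truncn_itv; rewrite mulr_ge0.
  have kL i (t : 'I_q) : (k0 i + t < 2 * M * n.+1)%N.
    rewrite -(ltr_nat R) natrD.
    have /andP[kx _] := k0P i.
    have tn : t%:R < n.+1%:R :> R.
      by rewrite ltr_nat n1 (leq_trans (ltn_ord t))// leq_pmull.
    apply: (le_lt_trans (lerD kx (ltW tn))).
    rewrite -[X in _ + X < _]mul1r -mulrDl natrM ltr_pM2r ?ltr0n//.
    have := le_trans (lerD (ler_norm (x0 0 i)) (lexx 2)) (xM i).
    rewrite mul2n -addnn natrD => H; rewrite -ltrBrDr addrAC ltrD2r ltrBrDr.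
    by apply: lt_le_trans H; rewrite ltrD2l ltr1n.
  pose sub (t : {ffun 'I_d -> 'I_q}) : {ffun 'I_d -> 'I_(2 * M * n.+1)} :=
    [ffun i => Ordinal (kL i (t i))].
  have sub_inj : injective sub.
    move=> s t /ffunP st; apply/ffunP => i; have := st i; rewrite !ffunE => -[].
    by move=> /addnI /val_inj.
  have near_sub t i : `|x0 0 i - gridpt (sub t) 0 i| < r.
    rewrite mxE ffunE /= distrC -addrA -opprD [M%:R + _]addrC.
    apply: le_lt_trans pr; rewrite -qh.
    have -> : x0 0 i + M%:R = (x0 0 i + M%:R) * n.+1%:R * mesh n.
      by rewrite -mulrA mesh_natr mulr1.
    rewrite -mulrBl normrM [`|mesh n|]gtr0_norm// ler_pM2r//.
    have /andP[kx xk] := k0P i.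
    rewrite ler_norml natrD.
    have q1 : 1 <= q%:R :> R by rewrite ler1n.
    have tq : (t i)%:R <= q%:R :> R by rewrite ler_nat ltnW.
    have t0 : 0 <= (t i)%:R :> R by [].
    move: kx xk q1 tq t0; rewrite -[(k0 i).+1%:R]natr1.
    move: ((x0 0 i + M%:R) * n.+1%:R) (k0 i)%:R (t i)%:R q%:R => X a b e.
    by lra.
  have lower : p%:R^-1 ^+ d * eps <= riemann M n u.
    rewrite /riemann -qh exprMn [_ ^+ d * _ ^+ d]mulrC -mulrA.
    rewrite ler_wpM2l ?exprn_ge0 ?mesh_ge0//.
    apply: (@le_trans _ _ (\sum_t u (gridpt (sub t)))).
      rewrite -natrX mulr_natl -[X in (X ^ d)%N](card_ord q) -[X in (_ ^ X)%N](card_ord d).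
      rewrite -card_ffun -sumr_const; apply: ler_sum => t _; apply: Hr => i.
      exact: near_sub.
    rewrite -(big_imset (fun k => u (gridpt k)) (in2W sub_inj)) /=.
    rewrite big_mkcond /=; apply: ler_sum => k _; case: ifP => //.
  have := le_trans lower (le_trans (ler_norm _) (HC n)).
  rewrite /mesh ler_pdivlMr ?ltr0n// n1 natrM mulrA//.
(* The bound [key] says [c * q <= C] for every positive [q], which fails once [q] exceeds
   [C / c]. *)
pose c := p%:R^-1 ^+ d * eps * p%:R.
have c0 : 0 < c.
  by apply: mulr_gt0 => //; apply: mulr_gt0 => //; rewrite exprn_gt0 ?invr_gt0.
have := key (Num.truncn (C / c)).+1 isT; rewrite -/c mulrC -ler_pdivlMr//.
by rewrite leNgt truncnS_gt.
Qed.

End RiemannSums.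

(** * Complex-valued functions and the Hermitian integrand *)

Section ComplexValued.
Set Implicit Arguments.
Unset Strict Implicit.
Context {R : realType} {d : nat}.
Implicit Types (u v : 'rV[R]_d -> R) (f g : 'rV[R]_d -> R[i]) (i j : 'I_d).
Implicit Types (x : 'rV[R]_d) (K : set 'rV[R]_d).

Definition re_part f : 'rV[R]_d -> R := fun x => complex.Re (f x).
Definition im_part f : 'rV[R]_d -> R := fun x => complex.Im (f x).
Definition conj_fun f : 'rV[R]_d -> R[i] := fun x => conjc (f x).

Lemma re_partM f g : re_part (f * g) = re_part f * re_part g - im_part f * im_part g.
Proof. by apply/funext => x; rewrite /re_part /im_part !fctE; case: (f x) (g x) => [? ?] []. Qed.

Lemma im_partM f g : im_part (f * g) = re_part f * im_part g + im_part f * re_part g.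
Proof. by apply/funext => x; rewrite /re_part /im_part !fctE; case: (f x) (g x) => [? ?] []. Qed.

Lemma re_part_conj f : re_part (conj_fun f) = re_part f.
Proof. by apply/funext => x; rewrite /re_part /conj_fun; case: (f x). Qed.

Lemma im_part_conj f : im_part (conj_fun f) = - im_part f.
Proof. by apply/funext => x; rewrite /im_part /conj_fun !fctE; case: (f x). Qed.

Lemma csmooth_re f : csmooth f -> smooth (re_part f).
Proof. exact: proj1. Qed.

Lemma csmooth_im f : csmooth f -> smooth (im_part f).
Proof. exact: proj2. Qed.

Lemma csmooth_parts f : smooth (re_part f) -> smooth (im_part f) -> csmooth f.
Proof. exact: conj. Qed.

Lemma csmooth_mul f g : csmooth f -> csmooth g -> csmooth (f * g).
Proof.
move=> sf sg; have fr := csmooth_re sf; have fi := csmooth_im sf.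
have gr := csmooth_re sg; have gi := csmooth_im sg.
apply: csmooth_parts.
- by rewrite re_partM; exact: (smooth_sub (smooth_mul fr gr) (smooth_mul fi gi)).
- by rewrite im_partM; exact: (smooth_add (smooth_mul fr gi) (smooth_mul fi gr)).
Qed.

Lemma csmooth_conj f : csmooth f -> csmooth (conj_fun f).
Proof.
move=> sf; apply: csmooth_parts; first by rewrite re_part_conj; exact: csmooth_re.
by rewrite im_part_conj; apply: smooth_opp; exact: csmooth_im.
Qed.

Lemma pderivB i u v : smooth u -> smooth v ->
  pderiv i (u - v) = pderiv i u - pderiv i v.
Proof.
by move=> su sv; apply/funext => x; rewrite /pderiv deriveB//; apply: smooth_derivable.
Qed.

Lemma pderivN i u : smooth u -> pderiv i (- u) = - pderiv i u.
Proof.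
by move=> su; apply/funext => x; rewrite /pderiv deriveN//; apply: smooth_derivable.
Qed.

Lemma cpderivM i f g : csmooth f -> csmooth g ->
  cpderiv i (f * g) = f * cpderiv i g + cpderiv i f * g.
Proof.
move=> sf sg; have fr := csmooth_re sf; have fi := csmooth_im sf.
have gr := csmooth_re sg; have gi := csmooth_im sg.
apply/funext => x; rewrite /cpderiv.
rewrite -/(re_part (f * g)) -/(im_part (f * g)) re_partM im_partM.
have M u v : smooth u -> smooth v -> smooth (u * v) := @smooth_mul _ _ u v.
rewrite (pderivB i (M _ _ fr gr) (M _ _ fi gi)) (pderivD i (M _ _ fr gi) (M _ _ fi gr)).
rewrite (pderivM i fr gr) (pderivM i fi gi) (pderivM i fr gi) (pderivM i fi gr).
rewrite !fctE /re_part /im_part /=.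
move: (pderiv i _ x) (pderiv i _ x) (pderiv i _ x) (pderiv i _ x) => a b a' b'.
by case: (f x) (g x) => [p q] [p' q']; congr Complex => /=; ring.
Qed.

Lemma cpderiv_conj i f : csmooth f -> cpderiv i (conj_fun f) = conj_fun (cpderiv i f).
Proof.
move=> sf; apply/funext => x; rewrite /conj_fun /cpderiv /=.
rewrite -/(re_part (conj_fun f)) -/(im_part (conj_fun f)) re_part_conj im_part_conj.
by rewrite (pderivN i (csmooth_im sf)).
Qed.

Lemma cpderivC i j f : csmooth f -> cpderiv i (cpderiv j f) = cpderiv j (cpderiv i f).
Proof.
move=> sf.
have E k l g : cpderiv k (cpderiv l g) = (fun x =>
  (pderiv k (pderiv l (re_part g)) x +i* pderiv k (pderiv l (im_part g)) x)%C) := erefl.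
by rewrite !E (pderivC i j (csmooth_re sf)) (pderivC i j (csmooth_im sf)).
Qed.

Definition cnull f : Prop := null (re_part f) /\ null (im_part f).

Lemma cnull_lin (a : R[i]) f g : cnull f -> cnull g -> cnull (a *: f + g).
Proof.
move=> [fr fi] [gr gi]; split; rewrite /re_part /im_part.
- by rewrite Re_scaleD; do 2 apply: null_lin => //.
- by rewrite Im_scaleD; do 2 apply: null_lin => //.
Qed.

Lemma cnull0 : cnull 0.
Proof. by split; exact: null0. Qed.

Lemma cnull_add f g : cnull f -> cnull g -> cnull (f + g).
Proof. by move=> nf ng; rewrite -[f]scale1r; exact: cnull_lin. Qed.

Lemma cnull_opp f : cnull f -> cnull (- f).
Proof. by move=> nf; rewrite -[- f]addr0 -scaleN1r; exact: cnull_lin nf cnull0. Qed.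

Lemma cnull_sub f g : cnull f -> cnull g -> cnull (f - g).
Proof. by move=> nf ng; apply: cnull_add => //; exact: cnull_opp. Qed.

Lemma cnull_cpderiv K f i : csmooth f -> compact K -> (forall x, ~ K x -> f x = 0) ->
  cnull (cpderiv i f).
Proof.
move=> [fr fi] cK fK; split.
- by apply: (@null_pderiv _ _ K) fr cK _ => x /fK ->.
- by apply: (@null_pderiv _ _ K) fi cK _ => x /fK ->.
Qed.

(** Integrand of the [L^2] inner product. *)
Definition herm f g : 'rV[R]_d -> R[i] := f * conj_fun g.

Lemma hermE f g x : herm f g x = f x * conjc (g x).
Proof. by []. Qed.

Lemma herm0l g : herm 0 g = 0.
Proof. exact: mul0r. Qed.

Lemma herm0r f : herm f 0 = 0.
Proof. by apply/funext => x; rewrite hermE conjc0 mulr0. Qed.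

(** The real part of [herm f f] is the nonnegative function [|f|^2], to which [null_ge0_eq0]
    applies. *)
Lemma cnull_norm_eq0 f : csmooth f -> cnull (herm f f) -> f = 0.
Proof.
rewrite /herm.
move=> sf; have fr := csmooth_re sf; have fi := csmooth_im sf.
move=> [+ _]; rewrite re_partM re_part_conj im_part_conj mulrN opprK => nf.
have ge0 x : 0 <= (re_part f * re_part f + im_part f * im_part f) x.
  by rewrite !fctE addr_ge0// -expr2 sqr_ge0.
have E x : (re_part f * re_part f + im_part f * im_part f) x = 0.
  apply: (null_ge0_eq0 _ ge0 nf).
  exact: (smooth_continuous (smooth_add (smooth_mul fr fr) (smooth_mul fi fi))).
apply/funext => x; have := E x; rewrite !fctE /re_part /im_part.
case: (f x) => a b /= /eqP; rewrite paddr_eq0 -?expr2 ?sqr_ge0//.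
by rewrite !sqrf_eq0 => /andP[/eqP -> /eqP ->].
Qed.

End ComplexValued.

(** * Constant-coefficient operators, their adjoints and commutators *)

Section TestFunctionOperators.
Set Implicit Arguments.
Unset Strict Implicit.
Context {R : realType} {d : nat} {Omega : set 'rV[R]_d}.
Local Notation V := (testfun Omega).
Implicit Types (f g : V) (i j : 'I_d) (S T : V -> V).

Lemma testfun_eq f g : testfun_val f = testfun_val g -> f = g.
Proof. exact: val_inj. Qed.

Lemma testfun_linE (a : R[i]) f g x : (a *: f + g : V) x = a * f x + g x.
Proof. by []. Qed.

Lemma conj_testfun_lin (a : R[i]) f g x :
  conjc ((a *: f + g : V) x) = conjc a * conjc (f x) + conjc (g x).
Proof. by rewrite testfun_linE rmorphD rmorphM. Qed.

Lemma csmooth_testfun f : csmooth f.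
Proof. by have [] := testfunP f. Qed.

Lemma tpderivC i j f : tpderiv i (tpderiv j f) = tpderiv j (tpderiv i f).
Proof.
exact/testfun_eq/cpderivC/csmooth_testfun.
Qed.

Lemma tpderivB i f g : tpderiv i (f - g) = tpderiv i f - tpderiv i g.
Proof. exact: linearB. Qed.

Definition ccoord j : 'rV[R]_d -> R[i] := fun x => (coord j x +i* 0)%C.

Lemma csmooth_ccoord j : csmooth (ccoord j).
Proof. by split; [exact: smooth_coord|exact: smooth0]. Qed.

Lemma tcoord_subproof j f : ccoord j * (f : 'rV[R]_d -> R[i]) \in test_pred Omega.
Proof.
have [sf cf fO] := testfunP f; apply/asboolP.
have sub : supp (ccoord j * (f : 'rV[R]_d -> R[i])) `<=` supp f.
  by apply: closure_subset => x /=; apply: contra_neq => fx; rewrite fctE fx mulr0.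
split; first exact: csmooth_mul (csmooth_ccoord j) sf.
- by apply: (subclosed_compact _ cf sub); exact: closed_closure.
- exact: subset_trans sub fO.
Qed.

Definition tcoord j f : V := TestFun (tcoord_subproof j f).

Lemma tcoord_linear j : linear (tcoord j).
Proof.
move=> a f g; apply: testfun_eq; rewrite testfun_valD /=; apply/funext => x.
by rewrite !fctE mulrDr /GRing.scale /= mulrCA.
Qed.

Lemma tpderiv_tcoord i j f :
  tpderiv i (tcoord j f) = tcoord j (tpderiv i f) + (i == j)%:R *: f.
Proof.
apply: testfun_eq; rewrite [LHS]/= cpderivM; last exact: csmooth_testfun.
  rewrite /=; congr (_ + _); apply/funext => x; rewrite !fctE /GRing.scale /=.
  congr (_ * _); rewrite /cpderiv /= (_ : pderiv i _ x = (i == j)%:R).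
    rewrite (_ : pderiv i _ x = 0); first by case: (i == j).
    exact: derive_cst.
  by rewrite -[LHS]/(pderiv i (coord j) x) pderiv_coord.
exact: csmooth_ccoord.
Qed.

(** Formal adjoint for the [L^2] inner product, equality of integrals being expressed by [cnull] of
    the difference. *)
Definition adjoint T T' : Prop := forall f g : V,
  cnull (herm (T f) g - herm f (T' g)).

(** Integration by parts: the sum is the derivative of the compactly supported function
    [herm f g]. *)
Lemma cnull_tpderiv i f g : cnull (herm (tpderiv i f) g + herm f (tpderiv i g)).
Proof.
rewrite /herm /= -cpderiv_conj; last exact: csmooth_testfun.
have sf := csmooth_testfun f; have sg := csmooth_conj (csmooth_testfun g).
rewrite addrC -cpderivM//; have [_ cf _] := testfunP f.
apply: cnull_cpderiv cf _; first exact: csmooth_mul.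
by move=> x xf; rewrite fctE supp0 ?mul0r// notin_setE.
Qed.

Lemma testfun_cnull_eq0 f : cnull (herm f f) -> f = 0.
Proof.
by move=> /(cnull_norm_eq0 (csmooth_testfun f)) H; apply: testfun_eq; rewrite H.
Qed.

(** The constant-coefficient operators, generated inductively so that commutation, adjoints and
    commutators are obtained by induction. *)
Inductive diffop : (V -> V) -> Prop :=
| diffop0 : diffop (fun=> 0)
| diffop_id : diffop id
| diffop_tpderiv i T : diffop T -> diffop (tpderiv i \o T)
| diffop_lin (a : R[i]) S T : diffop S -> diffop T -> diffop (fun f => a *: S f + T f).

Lemma diffop_linear T : diffop T -> linear T.
Proof.
elim=> {T} [|//|i T _ IH|b S T _ IHS _ IHT] a f g.
- by rewrite scaler0 addr0.
- by rewrite /= IH tpderiv_linear.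
- by rewrite IHS IHT !scalerDr !scalerA mulrC addrACA.
Qed.

Lemma linear_at0 T : linear T -> T 0 = 0.
Proof. by move=> /(_ (-1) 0 0); rewrite scaler0 addr0 scaleN1r addNr. Qed.

Lemma diffop_comm_tpderiv T i f : diffop T -> tpderiv i (T f) = T (tpderiv i f).
Proof.
move=> dT; elim: dT f => {T} [|//|j T _ IH|a S T _ IHS _ IHT] f.
- by rewrite linear0.
- by rewrite /= tpderivC IH.
- by rewrite tpderiv_linear IHS IHT.
Qed.

Lemma diffopC S T f : diffop S -> diffop T -> S (T f) = T (S f).
Proof.
move=> dS dT; elim: dS f => {S} [|//|i S _ IH|a S1 S2 _ IH1 _ IH2] f.
- by rewrite (linear_at0 (diffop_linear dT)).
- by rewrite /= IH diffop_comm_tpderiv.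
- by rewrite IH1 IH2 (diffop_linear dT).
Qed.

Lemma diffop_adjoint T : diffop T -> exists2 T', diffop T' & adjoint T T'.
Proof.
elim=> {T} [||i T dT [T' dT' TT']|a S T _ [S' dS' SS'] _ [T' dT' TT']].
- exists (fun=> 0); first exact: diffop0.
  move=> f g; rewrite (_ : _ - _ = 0); first exact: cnull0.
  by rewrite [X in X - _]herm0l [X in _ - X]herm0r subr0.
- exists id; first exact: diffop_id.
  by move=> f g; rewrite subrr; exact: cnull0.
- exists (fun g => -1 *: tpderiv i (T' g) + 0).
    exact: (diffop_lin (-1) (diffop_tpderiv i dT') diffop0).
  move=> f g.
  (* First [tpderiv i] is moved onto [g], then [T] onto [tpderiv i g]; as [T'] commutes with
     [tpderiv i], the adjoint is minus [tpderiv i \o T']. *)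
  have := cnull_sub (cnull_tpderiv i (T f) g) (TT' f (tpderiv i g)).
  rewrite -(diffop_comm_tpderiv i g dT'); congr cnull; apply/funext => x.
  rewrite !fctE !hermE conj_testfun_lin; rewrite (_ : (0 : V) x = 0)// conjc0 rmorphN1.
  by ring.
- exists (fun g => conjc a *: S' g + T' g); first exact: diffop_lin.
  move=> f g; have := cnull_lin a (SS' f g) (TT' f g).
  congr cnull; apply/funext => x.
  rewrite !fctE !hermE conj_testfun_lin testfun_linE conjcK.
  by rewrite /GRing.scale /=; ring.
Qed.

Definition commutator j T : V -> V := fun f => T (tcoord j f) - tcoord j (T f).

(** By the product rule, [[D_i T, x_j]] is [D_i [T, x_j]], plus [T] when [i = j]. *)
Lemma diffop_commutator j T : diffop T -> diffop (commutator j T).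
Proof.
elim=> {T} [||i T dT IH|a S T dS IHS dT IHT].
- rewrite (_ : commutator _ _ = (fun=> 0)); first exact: diffop0.
  by apply/funext => f; rewrite /commutator (linear_at0 (tcoord_linear j)) subr0.
- rewrite (_ : commutator _ _ = (fun=> 0)); first exact: diffop0.
  by apply/funext => f; rewrite /commutator subrr.
- have -> : commutator j (tpderiv i \o T) =
      (fun f => (i == j)%:R *: T f + (tpderiv i \o commutator j T) f).
    apply/funext => f; rewrite /commutator /= tpderivB tpderiv_tcoord.
    by rewrite [RHS]addrC opprD !addrA subrK.
  by apply: diffop_lin => //; exact: diffop_tpderiv.
- have -> : commutator j (fun f => a *: S f + T f) =
      (fun f => a *: commutator j S f + commutator j T f).
    apply/funext => f; rewrite /commutator tcoord_linear.
    by rewrite opprD addrACA scalerBr.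
  exact: diffop_lin.
Qed.

Lemma commutator_kernel j T f : diffop T -> T f = 0 -> commutator j T f = 0.
Proof.
move=> dT Tf; have [T' dT' TT'] := diffop_adjoint dT.
(* The adjoint relation pairs [T (T' f) = T' (T f) = 0] with [f], so [herm (T' f) (T' f)] is
   null. *)
have T'f : T' f = 0.
  apply: testfun_cnull_eq0; have := cnull_opp (TT' (T' f) f).
  rewrite (diffopC _ dT dT') Tf (linear_at0 (diffop_linear dT')).
  by rewrite opprB [X in _ - X]herm0l subr0.
(* Only the first factor of the pairing is rewritten: [T] then passes to the second one, where [T']
   commutes with the commutator and kills [f]. *)
have QE : commutator j T f = T (tcoord j f).
  by rewrite /commutator Tf (linear_at0 (tcoord_linear j)) subr0.
apply: testfun_cnull_eq0; rewrite {1}QE.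
have := TT' (tcoord j f) (commutator j T f).
rewrite (diffopC _ dT' (diffop_commutator j dT)) T'f.
rewrite (linear_at0 (diffop_linear (diffop_commutator j dT))).
by rewrite [X in _ - X]herm0r subr0.
Qed.

End TestFunctionOperators.

(** * Injectivity by lowering the order *)

Section Injectivity.
Set Implicit Arguments.
Unset Strict Implicit.
Context {R : realType} {d : nat} {Omega : set 'rV[R]_d}.
Local Notation V := (testfun Omega).
Implicit Types (f g : V) (i j : 'I_d) (S T : V -> V) (a : 'I_d -> nat).

(** Truncation at [a j = 0] is harmless: in [tdiff_tcoord] the term then has coefficient 0. *)
Definition decr j a : 'I_d -> nat := fun i => if i == j then (a i).-1 else a i.

Lemma iter_tpderiv_linear i n : linear (iter n (@tpderiv _ _ Omega i)).
Proof. by elim: n => [//|n IH] b f g /=; rewrite IH tpderiv_linear. Qed.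

Lemma iter_tpderiv_tcoord i j n f : iter n (tpderiv i) (tcoord j f) =
  tcoord j (iter n (tpderiv i) f) + ((i == j) * n)%:R *: iter n.-1 (tpderiv i) f.
Proof.
elim: n => [|n IH]; first by rewrite muln0 scale0r addr0.
rewrite iterS IH addrC tpderiv_linear tpderiv_tcoord -iterS.
rewrite addrC -addrA; congr (_ + _).
(* For [n = 0] the predecessor is truncated, but its coefficient vanishes; otherwise the two
   multiples of the same derivative add up. *)
case: n {IH} => [|n]; first by rewrite muln0 scale0r addr0 muln1.
by rewrite -[iter n.+1.-1.+1 _ _]/(iter n.+1 (tpderiv i) f) -scalerDl -natrD -mulnS.
Qed.

Lemma foldr_decr j a (s : seq 'I_d) f : j \notin s ->
  foldr (fun i => iter (decr j a i) (tpderiv i)) f s =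
  foldr (fun i => iter (a i) (tpderiv i)) f s.
Proof.
elim: s => [//|i s IH] /=; rewrite in_cons negb_or => /andP[ji js].
by rewrite IH// /decr eq_sym (negbTE ji).
Qed.

Lemma foldr_tpderiv_tcoord j a (s : seq 'I_d) f : uniq s ->
  foldr (fun i => iter (a i) (tpderiv i)) (tcoord j f) s =
  tcoord j (foldr (fun i => iter (a i) (tpderiv i)) f s) +
  ((j \in s) * a j)%:R *: foldr (fun i => iter (decr j a i) (tpderiv i)) f s.
Proof.
elim: s => [_|i s IH] /=; first by rewrite mul0n scale0r addr0.
move=> /andP[i_s us]; rewrite IH// addrC iter_tpderiv_linear iter_tpderiv_tcoord.
rewrite addrC -addrA; congr (_ + _); rewrite in_cons.
have [ij|ij] := eqVneq i j; last first.
  by rewrite /= mul0n scale0r add0r {2}/decr (negbTE ij).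
by subst j; rewrite (negbTE i_s) mul0n scale0r addr0 !mul1n foldr_decr// /decr eqxx.
Qed.

(** The commutator with [x_j] acts on the symbol as differentiation in the [j]-th variable. *)
Lemma tdiff_tcoord j a f :
  tdiff a (tcoord j f) = tcoord j (tdiff a f) + (a j)%:R *: tdiff (decr j a) f.
Proof. by rewrite /tdiff foldr_tpderiv_tcoord ?enum_uniq// mem_enum mul1n. Qed.

Lemma linear_sumZ (I : Type) (r : seq I) (b : I -> R[i]) (F : I -> V) T :
  linear T -> T (\sum_(k <- r) b k *: F k) = \sum_(k <- r) b k *: T (F k).
Proof.
move=> linT; elim: r => [|k r IH]; first by rewrite !big_nil linear_at0.
by rewrite !big_cons linT IH.
Qed.

Lemma diffop_iter i n T : diffop T -> diffop (iter n (@tpderiv _ _ Omega i) \o T).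
Proof. by move=> dT; elim: n => [//|n IH]; exact: (diffop_tpderiv i IH). Qed.

Lemma diffop_tdiff a : diffop (@tdiff _ _ Omega a).
Proof.
rewrite /tdiff; elim: (enum 'I_d) => [|i s IH]; first exact: diffop_id.
exact: (diffop_iter i (a i) IH).
Qed.

Lemma diffop_sum (I : Type) (r : seq I) (b : I -> R[i]) (A : I -> V -> V) :
  (forall k, diffop (A k)) -> diffop (fun f => \sum_(k <- r) b k *: A k f).
Proof.
move=> dA; elim: r => [|k r IH].
  rewrite (_ : (fun _ => _) = (fun=> 0)); first exact: diffop0.
  by apply/funext => f; rewrite big_nil.
rewrite (_ : (fun _ => _) = (fun f => b k *: A k f + \sum_(l <- r) b l *: A l f)).
  exact: diffop_lin.
by apply/funext => f; rewrite big_cons.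
Qed.

Lemma tdiff0 a f : (forall i, a i = 0%N) -> tdiff a f = f.
Proof. by move=> a0; rewrite /tdiff; elim: (enum _) => [//|i s IH] /=; rewrite a0 IH. Qed.

Lemma mlength_decr j a : (0 < a j)%N -> mlength a = (mlength (decr j a)).+1.
Proof.
move=> aj; rewrite /mlength (bigD1 j)//= [in RHS](bigD1 j)//= /decr eqxx.
rewrite -addSn prednK//; congr (_ + _)%N; apply: eq_bigr => i /negbTE ij.
by rewrite ij.
Qed.

(* Commuting with a coordinate lowers the multi-index by one, so after
   finitely many steps only the leading term [k0] survives, as a constant. *)
Lemma diffop_injective (I : finType) (k0 : I) n (b : I -> R[i])
    (a : I -> 'I_d -> nat) f :
  b k0 != 0 -> mlength (a k0) = n ->
  (forall k, b k != 0 -> (mlength (a k) <= n)%N) ->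
  (forall k, b k != 0 -> a k =1 a k0 -> k = k0) ->
  \sum_k b k *: tdiff (a k) f = 0 -> f = 0.
Proof.
elim: n b a => [|n IH] b a bk0 ak0 amax ainj sum0.
  (* At length 0 every index with nonzero coefficient is the zero multi-index, so [ainj] leaves the
     term [k0] alone. *)
  have z k : mlength (a k) = 0%N -> forall i, a k i = 0%N.
    by move=> /eqP; rewrite /mlength sum_nat_eq0 => /forallP + i => /(_ i)/eqP.
  move: sum0; rewrite (bigD1 k0)//= big1 => [|k kk0].
    rewrite addr0 tdiff0 => [/eqP|]; last exact: z.
    by rewrite scaler_eq0 (negbTE bk0) => /eqP.
  have [->|bk] := eqVneq (b k) 0; first by rewrite scale0r.
  case/eqP: kk0; apply: ainj => // i.
  by rewrite (z k0 ak0) (z k)//; apply/eqP; rewrite -leqn0 amax.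
have [j aj] : exists j, (0 < a k0 j)%N.
  apply: contrapT => aj; suff : mlength (a k0) = 0%N by rewrite ak0.
  rewrite /mlength big1// => j _; apply/eqP; rewrite -leqn0 leqNgt.
  by apply/negP => ajj; apply: aj; exists j.
(* Terms with [a k j = 0] get coefficient 0 and leave the hypotheses on nonzero coefficients. *)
apply: (IH (fun k => b k * (a k j)%:R) (fun k => decr j (a k))).
- by rewrite mulf_neq0// pnatr_eq0 -lt0n.
- by move: ak0; rewrite (mlength_decr aj) => -[].
- move=> k; rewrite mulf_eq0 negb_or pnatr_eq0 -lt0n => /andP[bk akj].
  by rewrite -ltnS -(mlength_decr akj) amax.
(* Lowering entry [j] is injective on multi-indices whose entry [j] is positive, so the leading one
   stays unique. *)
- move=> k; rewrite mulf_eq0 negb_or pnatr_eq0 -lt0n => /andP[bk akj] E.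
  apply: ainj => // i; have := E i; rewrite /decr; case: eqP => // -> akk.
  by rewrite -(prednK akj) -(prednK aj) akk.
- have dT := diffop_sum (index_enum I) b (fun k => diffop_tdiff (a k)).
  refine (etrans _ (commutator_kernel j dT sum0)).
  rewrite /commutator linear_sumZ; last exact: tcoord_linear.
  rewrite -sumrB; apply: eq_bigr => k _.
  by rewrite tdiff_tcoord scalerDr scalerA addrAC subrr add0r.
Qed.

End Injectivity.

(** * Extension of linear functionals by Zorn's lemma *)

Section ExtensionOfFunctionals.
Set Implicit Arguments.
Unset Strict Implicit.
Variables (K : fieldType) (V : lmodType K).
Implicit Types (A B : set (V * K)).

(** Graphs of partially defined linear functionals; linearity reduces single-valuedness to the value
    at 0. *)
Definition lin_rel A : Prop :=
  (forall a p q, A p -> A q -> A (a *: p.1 + q.1, a * p.2 + q.2)) /\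
  (forall k, A (0, k) -> k = 0).

Lemma algdual0 (T : algdual V) : T 0 = 0.
Proof. by have := algdual_scalar T (-1) 0 0; rewrite scaler0 addr0 mulN1r addNr. Qed.

Lemma algdual_sumZ (T : algdual V) (I : Type) (r : seq I) (b : I -> K) (F : I -> V) :
  T (\sum_(k <- r) b k *: F k) = \sum_(k <- r) b k * T (F k).
Proof.
elim: r => [|k r IH]; first by rewrite !big_nil algdual0.
by rewrite !big_cons algdual_scalar IH.
Qed.

Lemma lin_rel_fun A v k l : lin_rel A -> A (v, k) -> A (v, l) -> k = l.
Proof.
move=> [linA funA] Ak Al; have := linA (-1) _ _ Ak Al.
rewrite /= scaleN1r addNr => /funA/eqP.
by rewrite mulN1r addrC subr_eq0 => /eqP ->.
Qed.

(** If [v] is outside the domain, it is adjoined with value 0. *)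
Lemma lin_rel_extend A v : lin_rel A -> A (0, 0) ->
  exists2 B, lin_rel B & A `<=` B /\ exists k, B (v, k).
Proof.
move=> linA A0; have [[k Ak]|vA] := pselect (exists k, A (v, k)).
  by exists A => //; split => //; exists k.
have [lA fA] := linA.
exists [set p | exists a u, A (u, p.2) /\ p.1 = u + a *: v]; split.
- move=> c [p1 p2] [q1 q2] /= [a [u [Au ->]]] [b [w [Aw ->]]].
  exists (c * a + b), (c *: u + w); split; first exact: (lA c _ _ Au Aw).
  by rewrite scalerDr scalerDl scalerA addrACA.
- move=> k /= [a [u [Au E]]].
  have [a0|a0] := eqVneq a 0.
    by apply: fA; rewrite a0 scale0r addr0 in E; rewrite E.
  (* Here [u + a *: v = 0] with [a] nonzero would put [v], a multiple of [u], in the domain of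
     [A]. *)
  case: vA; exists (- a^-1 * k + 0); have := lA (- a^-1) _ _ Au A0; congr A.
  congr pair; rewrite /= addr0 scaleNr.
  have -> : u = - (a *: v) by apply/eqP; rewrite -addr_eq0 -E.
  by rewrite scalerN opprK scalerA mulVf// scale1r.
- by move=> [u k] Au /=; exists 0, u; rewrite scale0r addr0.
- by exists 0, 1, 0; rewrite scale1r add0r.
Qed.

Lemma lin_rel_total A : lin_rel A -> A (0, 0) ->
  exists2 B, lin_rel B & A `<=` B /\ forall v, exists k, B (v, k).
Proof.
move=> linA A0.
(* The empty relation is admitted so that the empty chain has a bound. *)
pose P B := lin_rel B /\ (B !=set0 -> A `<=` B).
have [F FP Ftot|B [[linB AB] Bmax]] := @Zorn_bigcup _ P.
  split; last first.
    by move=> [p [B FB Bp]] q Aq; exists B => //; have [_] := FP _ FB; apply => //; exists p.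
  split.
    move=> a p q [B FB Bp] [C FC Cq].
    have [BC|CB] := Ftot _ _ FB FC.
      by exists C => //; have [[lC _] _] := FP _ FC; apply: lC => //; exact: BC.
    by exists B => //; have [[lB _] _] := FP _ FB; apply: lB => //; exact: CB.
  by move=> k [B FB Bk]; have [[_ fB] _] := FP _ FB; exact: fB.
(* An empty [B] would be properly contained in the admissible relation [A]. *)
have B0 : B !=set0.
  apply: contrapT => B0; apply: (Bmax A).
    split; first by move=> p Bp; case: B0; exists p.
    by move=> AB0; apply: B0; exists (0, 0); exact: AB0.
  by split => // _.
have {}AB := AB B0; exists B => //; split => // v.
have [C linC [BC [k Cv]]] := lin_rel_extend v linB (AB _ A0).
apply: contrapT => vB; apply: (Bmax C).
  by split => // CB; apply: vB; exists k; exact: CB.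
by split => // _; exact: subset_trans BC.
Qed.

(** Injectivity makes [O v |-> T v] well defined on the range of [O]; any total linear extension is
    the required [U]. *)
Lemma injective_dual_surjective (O : {linear V -> V}) (T : algdual V) :
  injective O -> exists U : algdual V, forall v, U (O v) = T v.
Proof.
move=> Oinj; pose A : set (V * K) := [set p | exists2 v, p.1 = O v & p.2 = T v].
have linA : lin_rel A.
  split=> [a p q [v pv pT] [w qw qT]|k [v /= Ov ->]].
    exists (a *: v + w) => /=; first by rewrite pv qw linearP.
    by rewrite pT qT algdual_scalar.
  by rewrite (_ : v = 0) ?algdual0//; apply: Oinj; rewrite -Ov linear0.
have [|B linB [AB Btot]] := lin_rel_total linA.
  by exists 0; rewrite ?linear0 ?algdual0.
have [u Bu] := choice Btot.
have lin_u : scalar u.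
  move=> a v w; apply: (lin_rel_fun linB (Bu _)).
  by have [lB _] := linB; exact: (lB a _ _ (Bu v) (Bu w)).
exists (mk_algdual lin_u) => v.
by apply: (lin_rel_fun linB (Bu _)); apply: AB; exists v.
Qed.

End ExtensionOfFunctionals.

(** * The transposed operator and the conclusion *)

Section Transposed.
Set Implicit Arguments.
Unset Strict Implicit.
Context {R : realType} {d m : nat} {Omega : set 'rV[R]_d}.
Local Notation V := (testfun Omega).
Implicit Types (c : multiindex d m -> R[i]) (f : V).

(** The signs are those of the definition of [ddiff], moved from the functional to the test
    function. *)
Definition codual c f : V :=
  \sum_(a : multiindex d m) ((-1) ^+ mlength a * c a) *: tdiff a f.

Lemma codual_linear c : linear (codual c).
Proof.
exact: diffop_linear (diffop_sum _ _ (fun a : multiindex d m => diffop_tdiff a)).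
Qed.

HB.instance Definition _ c :=
  GRing.isLinear.Build R[i] V V *:%R (codual c) (codual_linear c).

Lemma multiindex_fun_inj (a b : multiindex d m) : a =1 b -> a = b.
Proof. by move=> ab; apply/val_inj/ffunP => i; apply: val_inj; exact: ab. Qed.

Lemma codual_injective c : (exists a, c a != 0) -> injective (codual c).
Proof.
move=> [a1 ca1] f g fg; apply/eqP; rewrite -subr_eq0; apply/eqP.
pose b (a : multiindex d m) : R[i] := (-1) ^+ mlength a * c a.
have bE a : (b a != 0) = (c a != 0) by rewrite mulf_eq0 signr_eq0.
(* The leading term is any one of maximal length among the nonzero coefficients;
   [multiindex_fun_inj] separates it from others of the same length. *)
have := @arg_maxnP _ a1 (fun a => c a != 0) (fun a : multiindex d m => mlength a) ca1.
case=> a0 ca0 a0max.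
refine (@diffop_injective _ _ _ (multiindex d m) a0 (mlength (multiindex_fun a0)) b
  (@multiindex_fun d m) _ _ _ _ _ _) => //.
- by rewrite bE.
- by move=> a; rewrite bE => /a0max.
- by move=> a _; exact: multiindex_fun_inj.
- by rewrite -[LHS]/(codual c (f - g)) linearB /= fg subrr.
Qed.

Lemma pdoE c (T : algdual V) f : pdo c T f = T (codual c f).
Proof.
rewrite algdual_sumZ /pdo.
rewrite (big_morph (fun U : algdual V => U f) (id1 := 0) (op1 := +%R))//.
by apply: eq_bigr => a _; rewrite -mulrA mulrCA.
Qed.

End Transposed.

Theorem mainTheorem4 (R : realType) (d m : nat) (Omega : set 'rV[R]_d)
    (c : multiindex d m -> R[i]) (Omega_open : open Omega)
    (c_neq0 : exists a, c a != 0) :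
  regular (pdo c : {linear algdual (testfun Omega) -> algdual (testfun Omega)})
  /\ (forall T : algdual (testfun Omega),
        exists U : algdual (testfun Omega), pdo c U = T).
Proof.
have Oinj := codual_injective (Omega := Omega) c_neq0; split.
  by exists (codual c) => // T f; exact: pdoE.
move=> T; have [U UE] := injective_dual_surjective T Oinj.
by exists U; apply: algdual_ext => f; rewrite pdoE UE.
Qed.
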